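(* Let $X$ be a deterministic dynamical system in $\mathsf{Stoch}$ with monoid $M$ acting by measurable functions $m:X\to X$. Let $q:X\to X/M$ be the quotient map onto the set of orbit classes, with $X/M$ carrying the quotient $\sigma$-algebra, and let $\tilde q:X_{\mathrm{inv}}\to X/M$ be the same map regarded as a measurable map on $X_{\mathrm{inv}}$. Then the Markov kernel $X_{\mathrm{inv}}\to X/M$ induced by $\tilde q$ is an isomorphism of $\mathsf{Stoch}_{\det}$; that is, it has a deterministic (i.e. zero-one) inverse in the category of Markov kernels.
   Context: $\mathsf{Stoch}$ is the category of measurable spaces and Markov kernels $k(B|x)$, with composition $(h\circ k)(C|x)=\int_Y h(C|y)\,k(dy|x)$ and identities $(A|x)\mapsto 1_A(x)$. A kernel $f:X\to Y$ is deterministic if $f(B|x)\in\{0,1\}$ for all $x\in X$ and $B\in\Sigma_Y$; $\mathsf{Stoch}_{\det}$ is the subcategory of deterministic kernels. A measurable function $f$ induces the deterministic kernel $(B|x)\mapsto 1$ if $f(x)\in B$ and $0$ otherwise. The dynamical system consists of a measurable space $X$ with an action of the monoid $M$ by measurable functions $m:X\to X$ (no assumption on the cardinality or structure of $M$). A measurable set $A\subseteq X$ is invariant if $m^{-1}(A)=A$ for all $m\in M$. $X_{\mathrm{inv}}$ is the set $X$ equipped with the $\sigma$-algebra of invariant measurable sets. $\sim_M$ is the equivalence relation on $X$ generated by the action: $x\sim_M y$ iff there are $m_1,\dots,m_n\in M$ and $x=x_0,x_1,\dots,x_n=y$ in $X$ with $m_i(x_{i-1})=x_i$ for $i$ odd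 and $m_i(x_i)=x_{i-1}$ for $i$ even. $X/M$ is the set of $\sim_M$-classes, with quotient map $q(x)=[x]$ and the quotient $\sigma$-algebra ($B\subseteq X/M$ is measurable iff $q^{-1}(B)\in\Sigma_X$). Since $q\circ m=q$ for all $m$, $q$ is also measurable with respect to the invariant $\sigma$-algebra, giving $\tilde q:X_{\mathrm{inv}}\to X/M$. *)

(* Defs.v *)
From HB Require Import structures.
From mathcomp Require Import all_boot all_order all_algebra.
From mathcomp Require Import all_classical all_reals all_analysis.

Set Implicit Arguments.
Unset Strict Implicit.
Unset Printing Implicit Defensive.

Import Order.TTheory GRing.Theory Num.Theory.
Import numFieldNormedType.Exports.

Local Open Scope classical_set_scope.
Local Open Scope quotient_scope.
Local Open Scope ereal_scope.

(* Morphisms of Stoch are the probability kernels R.-pker X ~> Y; their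
   composition is the library's mkcomp_noparam, which comes with a
   subprobability-kernel structure only. *)
Section stoch_comp.
Context d1 d2 d3 (X : measurableType d1) (Y : measurableType d2)
  (Z : measurableType d3) (R : realType).
Variables (k : R.-pker X ~> Y) (h : R.-pker Y ~> Z).

Let mkcomp_noparam_prob x : mkcomp_noparam k h x [set: Z] = 1.
Proof.
rewrite /mkcomp_noparam /= /kcomp_noparam.
under eq_integral do rewrite prob_kernel.
by rewrite integral_cst// mul1e prob_kernel.
Qed.

HB.instance Definition _ :=
  Kernel_isProbability.Build _ _ _ _ R (mkcomp_noparam k h) mkcomp_noparam_prob.

Definition stoch_comp : R.-pker X ~> Z := mkcomp_noparam k h.

Lemma stoch_compE x C : stoch_comp x C = \int[k x]_y h y C.
Proof. by []. Qed.

End stoch_comp.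

Notation "h \o_stoch k" := (stoch_comp k h)
  (at level 50, format "h  \o_stoch  k") : ereal_scope.

Definition stoch_id d (X : measurableType d) (R : realType) : R.-pker X ~> X :=
  kdirac (@measurable_id _ X setT).

(* A measure of the library is a function on all of [set X], with unspecified
   values outside the sigma-algebra: two kernels are the same morphism when they
   agree on measurable sets. *)
Definition stoch_eq d1 d2 (X : measurableType d1) (Y : measurableType d2)
    (R : realType) (k l : R.-pker X ~> Y) : Prop :=
  forall (x : X) (B : set Y), measurable B -> k x B = l x B.

Definition deterministic d1 d2 (X : measurableType d1) (Y : measurableType d2)
    (R : realType) (k : R.-pker X ~> Y) : Prop :=
  forall (x : X) (B : set Y), measurable B -> k x B = 0 \/ k x B = 1.

Definition stoch_det_iso d1 d2 (X : measurableType d1) (Y : measurableType d2)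
    (R : realType) (f : R.-pker X ~> Y) : Prop :=
  deterministic f /\
  exists g : R.-pker Y ~> X,
    [/\ deterministic g,
        stoch_eq (g \o_stoch f) (stoch_id X R) &
        stoch_eq (f \o_stoch g) (stoch_id Y R)].

Record measurable_action (M : monoidType) d (X : measurableType d) :=
  MeasurableAction {
    act :> M -> X -> X ;
    act1 : forall x, act 1%g x = x ;
    actM : forall m n x, act (m * n)%g x = act m (act n x) ;
    measurable_act : forall m, measurable_fun [set: X] (act m) }.

Section invariant_space.
Context (M : monoidType) d (X : measurableType d) (a : measurable_action M X).

Definition invariant_set (A : set X) : Prop :=
  measurable A /\ forall m : M, a m @^-1` A = A.

Definition inv_space (_ : measurable_action M X) : Type := X.

Let inv0 : invariant_set set0.
Proof. by split=> // m; rewrite preimage_set0. Qed.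

Let invC A : invariant_set A -> invariant_set (~` A).
Proof.
by move=> [mA iA]; split=> [|m]; [exact: measurableC | rewrite -preimage_setC iA].
Qed.

Let inv_bigcup (F : (set X)^nat) :
  (forall i, invariant_set (F i)) -> invariant_set (\bigcup_i F i).
Proof.
move=> iF; split=> [|m]; first by apply: bigcupT_measurable => i; case: (iF i).
by rewrite preimage_bigcup; apply: eq_bigcupr => i _; case: (iF i).
Qed.

Definition inv_display : measure_display -> measure_display.
Proof. exact. Qed.

HB.instance Definition _ := Pointed.copy (inv_space a) X.
HB.instance Definition _ := @isMeasurable.Build (inv_display d) (inv_space a)
  invariant_set inv0 invC inv_bigcup.

End invariant_space.

Section orbit_space.
Context (M : monoidType) d (X : measurableType d) (a : measurable_action M X).

(* x = x_0, x_1, ..., x_n = y with m_i x_(i-1) = x_i for i odd and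
   m_i x_i = x_(i-1) for i even; only x_0, ..., x_n and m_1, ..., m_n matter. *)
Definition orbit_rel (x y : X) : Prop :=
  exists (n : nat) (m : nat -> M) (s : nat -> X),
    [/\ s 0%N = x, s n = y &
        forall i, (1 <= i <= n)%N ->
          if odd i then a (m i) (s i.-1) = s i else a (m i) (s i) = s i.-1].

Lemma orbit_rel_refl x : orbit_rel x x.
Proof. by exists 0%N, (fun=> 1%g), (fun=> x); split=> // -[|i]. Qed.

(* a zigzag can be padded to even length by an identity step *)
Lemma orbit_rel_even x y : orbit_rel x y ->
  exists (n : nat) (m : nat -> M) (s : nat -> X),
    [/\ ~~ odd n, s 0%N = x, s n = y &
        forall i, (1 <= i <= n)%N ->
          if odd i then a (m i) (s i.-1) = s i else a (m i) (s i) = s i.-1].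
Proof.
move=> [n [m [s [s0 sn h]]]].
have [on|en] := boolP (odd n); last by exists n, m, s.
exists n.+1, (fun i => if (i <= n)%N then m i else 1%g),
  (fun i => if (i <= n)%N then s i else s n).
rewrite /= on ltnn; split=> // i /andP[i1].
rewrite leq_eqVlt ltnS => /predU1P[->/=|ilen].
  by rewrite on /= ltnn leqnn act1.
by rewrite ilen (leq_trans (leq_pred i) ilen); apply: h; rewrite i1.
Qed.

Lemma orbit_rel_sym x y : orbit_rel x y -> orbit_rel y x.
Proof.
move=> /orbit_rel_even[n [m [s [en s0 sn h]]]].
exists n, (fun i => m (n.+1 - i)%N), (fun i => s (n - i)%N).
rewrite subn0 subnn; split=> // -[|i]; rewrite ?ltn0 //= => lein.
have lein' := ltnW lein.
have := h (n - i)%N; rewrite subn_gt0 lein leq_subr => /(_ isT).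
rewrite subSS oddB// (negbTE en) /= -subnS.
by case: (odd i).
Qed.

Lemma orbit_rel_trans x y z : orbit_rel x y -> orbit_rel y z -> orbit_rel x z.
Proof.
move=> /orbit_rel_even[n [m [s [en s0 sn h]]]] [p [m' [s' [s'0 s'p h']]]].
exists (n + p)%N, (fun i => if (i <= n)%N then m i else m' (i - n)%N),
  (fun i => if (i <= n)%N then s i else s' (i - n)%N).
split=> [//||i /andP[i1 inp]].
  case: leqP => [|_]; last by rewrite addKn.
  rewrite -{2}(addn0 n) leq_add2l leqn0 => /eqP p0.
  by rewrite p0 addn0 sn -s'0 -p0.
case: (leqP i n) => [lein|ltni].
  by rewrite (leq_trans (leq_pred i) lein); apply: h; rewrite i1.
have := h' (i - n)%N; rewrite subn_gt0 ltni leq_subLR inp => /(_ isT).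
rewrite oddB ?(ltnW ltni)// (negbTE en) addbF.
have -> : (i - n).-1 = (i.-1 - n)%N by rewrite -!subn1 subnAC.
case: (leqP i.-1 n) => // le1.
have -> : i.-1 = n by apply/eqP; rewrite eqn_leq le1 -ltnS prednK.
by rewrite subnn s'0 sn.
Qed.

Definition orbit_relb : rel X := fun x y => `[< orbit_rel x y >].

Let orbit_relb_refl : reflexive orbit_relb.
Proof. by move=> x; apply/asboolP; exact: orbit_rel_refl. Qed.

Let orbit_relb_sym : symmetric orbit_relb.
Proof. by move=> x y; apply/asboolP/asboolP; exact: orbit_rel_sym. Qed.

Let orbit_relb_trans : transitive orbit_relb.
Proof.
by move=> y x z /asboolP xy /asboolP yz; apply/asboolP; exact: orbit_rel_trans yz.
Qed.

Canonical orbit_equiv : equiv_rel X :=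
  EquivRel orbit_relb orbit_relb_refl orbit_relb_sym orbit_relb_trans.

Definition orbit_space : Type := {eq_quot orbit_equiv}.

HB.instance Definition _ := Choice.on orbit_space.
HB.instance Definition _ := EqQuotient.on orbit_space.

Definition orbit_map (x : X) : orbit_space := (\pi_orbit_space x)%qT.

Lemma orbit_mapP x y : orbit_map x = orbit_map y <-> orbit_rel x y.
Proof. by split=> [/eqquotP/asboolP//|xy]; apply/eqquotP/asboolP. Qed.

Lemma orbit_map_act m x : orbit_map (a m x) = orbit_map x.
Proof.
apply/esym/orbit_mapP.
exists 1%N, (fun=> m), (fun i => if i is 0%N then x else a m x).
by split=> // -[|[]].
Qed.

Definition orbit_measurable (B : set orbit_space) : Prop :=
  measurable (orbit_map @^-1` B).

Let orbit_measurable0 : orbit_measurable set0.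
Proof. by rewrite /orbit_measurable preimage_set0. Qed.

Let orbit_measurableC B : orbit_measurable B -> orbit_measurable (~` B).
Proof. by rewrite /orbit_measurable -preimage_setC; exact: measurableC. Qed.

Let orbit_measurable_bigcup (F : (set orbit_space)^nat) :
  (forall i, orbit_measurable (F i)) -> orbit_measurable (\bigcup_i F i).
Proof. by rewrite /orbit_measurable preimage_bigcup; exact: bigcupT_measurable. Qed.

Definition orbit_display : measure_display -> measure_display.
Proof. exact. Qed.

HB.instance Definition _ := isPointed.Build orbit_space (orbit_map point).
HB.instance Definition _ := @isMeasurable.Build (orbit_display d) orbit_space
  orbit_measurable orbit_measurable0 orbit_measurableC orbit_measurable_bigcup.

Definition orbit_map_inv : inv_space a -> orbit_space := orbit_map.

Lemma measurable_orbit_map_inv : measurable_fun [set: inv_space a] orbit_map_inv.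
Proof.
move=> _ B mB; rewrite setTI; split=> [//|m].
by apply/seteqP; split=> x; rewrite /preimage /= /orbit_map_inv orbit_map_act.
Qed.

End orbit_space.

Definition orbit_kernel (R : realType) (M : monoidType) d (X : measurableType d)
    (a : measurable_action M X) : R.-pker (inv_space a) ~> (orbit_space a) :=
  kdirac (measurable_orbit_map_inv (a := a)).

(* Main.v *)
Require Import Defs.
From HB Require Import structures.
From mathcomp Require Import all_boot all_order all_algebra.
From mathcomp Require Import all_classical all_reals all_analysis.

(** A kernel induced by a measurable function only depends on preimages of
    measurable sets, so it can be inverted by a function [g] for which [g \o f]
    is not the identity, provided that [g \o f] fixes all measurable sets under
    preimage ([kdirac_det_iso]).  Here [f] is the orbit map and [g] picks an
    arbitrary representative of each orbit.  The point [g (f x)] is in general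
    different from [x], but it lies in the orbit of [x], and an invariant set
    contains an orbit as soon as it meets it ([invariant_set_orbit]).  So no
    measurable set of [inv_space a] separates the two points.  The same fact
    makes [g] measurable, whatever the choice of representatives: the preimage
    under [g \o f] of an invariant set is that set ([repr_preimage]). *)

Set Implicit Arguments.
Unset Strict Implicit.
Unset Printing Implicit Defensive.

Local Open Scope classical_set_scope.
Local Open Scope ereal_scope.

Section dirac_kernels.
Context d1 d2 d3 (X : measurableType d1) (Y : measurableType d2)
  (Z : measurableType d3) (R : realType).

Lemma kdirac_deterministic (f : X -> Y) (mf : measurable_fun setT f) :
  deterministic (kdirac mf : R.-pker X ~> Y).
Proof.
move=> x B mB; rewrite /kdirac /= diracE.
by case: (_ \in _); [right | left].
Qed.

Lemma stoch_comp_kdirac (f : X -> Y) (g : Y -> Z)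
    (mf : measurable_fun setT f) (mg : measurable_fun setT g) x C :
  measurable C ->
  ((kdirac mg : R.-pker Y ~> Z) \o_stoch (kdirac mf : R.-pker X ~> Y)) x C
    = dirac (g (f x)) C :> \bar R.
Proof.
move=> mC; rewrite stoch_compE /kdirac /= integral_dirac//.
- by rewrite diracT mul1e.
- exact: (measurable_kernel (kdirac mg : R.-pker Y ~> Z) C mC).
Qed.

End dirac_kernels.

Lemma kdirac_det_iso d1 d2 (X : measurableType d1) (Y : measurableType d2)
    (R : realType) (f : X -> Y) (g : Y -> X)
    (mf : measurable_fun setT f) (mg : measurable_fun setT g) :
  (forall A, measurable A -> (g \o f) @^-1` A = A) ->
  (forall B, measurable B -> (f \o g) @^-1` B = B) ->
  stoch_det_iso (kdirac mf : R.-pker X ~> Y).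
Proof.
move=> gfK fgK; split; first exact: kdirac_deterministic.
exists (kdirac mg); split; first exact: kdirac_deterministic.
- move=> x A mA; rewrite stoch_comp_kdirac// /stoch_id /kdirac /= !diracE.
  by rewrite -[in RHS](gfK A mA).
- move=> y B mB; rewrite stoch_comp_kdirac// /stoch_id /kdirac /= !diracE.
  by rewrite -[in RHS](fgK B mB).
Qed.

Section orbit_representatives.
Context (M : monoidType) d (X : measurableType d) (a : measurable_action M X).

(** Both directions of a zigzag step are covered by [a m @^-1` A = A], which
    says that [A] holds at a point if and only if it holds at its image. *)
Lemma invariant_set_orbit (A : set X) x y :
  invariant_set a A -> orbit_rel a x y -> A x = A y.
Proof.
move=> [_ iA] [n [m [s [<- <- step]]]].
have actA k z : A (a k z) = A z by rewrite -[in RHS](iA k).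
elim: n step => [//|n IH] step.
rewrite IH; last first.
  by move=> i /andP[i1 ilen]; apply: step; rewrite i1 ltnW.
have := step n.+1; rewrite ltnSn => /(_ isT).
by case: ifP => _ /= <-; rewrite actA.
Qed.

Definition orbit_repr (y : orbit_space a) : inv_space a := repr y.

Lemma orbit_reprK : cancel orbit_repr (@orbit_map_inv M d X a).
Proof. by move=> y; exact: reprK. Qed.

Lemma repr_preimage (A : set (inv_space a)) : measurable A ->
  (orbit_repr \o @orbit_map_inv M d X a) @^-1` A = A.
Proof.
move=> mA; apply/funext => x; apply: (invariant_set_orbit mA).
by apply/orbit_mapP; exact: orbit_reprK.
Qed.

Lemma measurable_orbit_repr : measurable_fun setT orbit_repr.
Proof.
move=> _ A mA; rewrite setTI.
(* measurability in the orbit space is that of the preimage under the orbit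
   map, and this preimage is A itself *)
suff : measurable ((orbit_repr \o @orbit_map_inv M d X a) @^-1` A : set X) by [].
by rewrite repr_preimage//; case: mA.
Qed.

End orbit_representatives.

Theorem theoremA4 (R : realType) (M : monoidType) (d : measure_display)
    (X : measurableType d) (a : measurable_action M X) :
  stoch_det_iso (orbit_kernel R a).
Proof.
apply: (kdirac_det_iso _ _ (measurable_orbit_repr (a := a))).
- exact: repr_preimage.
- move=> B _; apply/funext => y.
  by rewrite /preimage /= orbit_reprK.
Qed.
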